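(* Let $\alpha$ be the unique solution of $4\alpha^{3}(3/2)^{1-1/(2\alpha)}=1$ in the interval $(1/2,2/3)$. Then, for all sufficiently large positive integers $n$, $$\operatorname{ex}(n,C_6)\leq \alpha n^{4/3}+O(n)<0.6144\, n^{4/3}.$$ That is, there exist constants $K>0$ and $n_0\in\mathbb{N}$ such that for every integer $n\geq n_0$ one has $\operatorname{ex}(n,C_6)\leq \alpha n^{4/3}+Kn$ and $\alpha n^{4/3}+Kn<0.6144\,n^{4/3}$.
   Context: Graphs are finite and simple. For a graph $F$, the Turán number $\operatorname{ex}(n,F)$ is the maximum number of edges in an $n$-vertex graph containing no subgraph (not necessarily induced) isomorphic to $F$. $C_6$ denotes the cycle of length six. The equation $4t^{3}(3/2)^{1-1/(2t)}=1$ has exactly one solution $t$ in $(1/2,2/3)$, which is denoted $\alpha$. *)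

(* Defs.v *)
From HB Require Import structures.
From mathcomp Require Import all_boot all_order all_algebra.
From mathcomp Require Import reals exp.

Set Implicit Arguments.
Unset Strict Implicit.
Unset Printing Implicit Defensive.

Import Order.TTheory GRing.Theory Num.Theory.

Local Open Scope ring_scope.

(* A simple graph on the vertex type T is given by its set of edges,
   each edge being a 2-element set of vertices. *)
Definition simple_graph (T : finType) (E : {set {set T}}) : bool :=
  [forall A in E, #|A| == 2%N].

(* The injection f need not reflect edges: subgraphs are not required to be
   induced. *)
Definition has_copy (U T : finType) (F : {set {set U}}) (E : {set {set T}})
  : bool :=
  [exists f : {ffun U -> T},
    injectiveb f && [forall A in F, [set f x | x in A] \in E]].

(* The maximum of an empty family is 0; this does not occur when F has an
   edge, since the edgeless graph is then F-free. *)
Definition turan_number (n : nat) (U : finType) (F : {set {set U}}) : nat :=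
  \max_(E : {set {set 'I_n}} | simple_graph E && ~~ has_copy F E) #|E|.

(* [ordS i] is the successor of i modulo k, so this is the cycle of length k
   for k >= 3. *)
Definition cycle_graph (k : nat) : {set {set 'I_k}} :=
  [set [set i; ordS i] | i : 'I_k].

Definition alpha_eqn (R : realType) (t : R) : Prop :=
  [/\ 1 / 2 < t, t < 2 / 3 &
      4 * t ^+ 3 * ((3 / 2) `^ (1 - 1 / (2 * t))) = 1].

(* Main.v *)
Require Import Defs.
From HB Require Import structures.
From mathcomp Require Import all_boot all_order all_algebra.
From mathcomp Require Import reals topology normedtype sequences realfun exp.
From mathcomp Require Import zify ring lra.

Set Implicit Arguments.
Unset Strict Implicit.
Unset Printing Implicit Defensive.

Import Order.TTheory GRing.Theory Num.Theory.
Import numFieldNormedType.Exports.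

Local Open Scope ring_scope.

(** The edges of a hexagon-free graph are bounded by counting paths with three
    edges.  Write [N] for twice the number of edges and [n] for the number of
    vertices.

    Keep only the paths [u a b v] in which neither turn [u a b], [a b v] closes a
    triangle and in which the ends of each turn have at most two common
    neighbours.  Two such paths with the same ends share their second or their
    third vertex, since otherwise they form a hexagon; hence at most two of them
    join [u] to [v], and if there are two then one of the turns is double: its
    ends have exactly two common neighbours ([good_paths_le2]).  So the paths,
    weighted by 1/2 when they have a double turn, have total weight at most one
    per pair of ends.  On the other hand almost every walk is such a path: once
    edges in many triangles are deleted, only boundedly many turns out of a given
    arc are excluded ([good_turns_many]), and these are a small proportion once
    vertices of bounded degree are deleted as well.  Both deletions cost a
    negligible part of the edges ([arcs_heavy], [exists_min_degree]).

    That all weights are at least 1/2 only gives [N^3 <= (2 + o(1)) n^4], which is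
    too weak.  The gain comes from a near-bipartition.  An arc is forked if many
    double turns begin with it; the two arcs of one edge are never both forked
    ([forked_asym]), because two consecutive double turns make a hexagon, up to
    boundedly many exceptions.  Therefore, if almost all paths have a double turn, the vertices split into
    hubs, entered by forked arcs, and non-hubs, with almost all edges in between,
    and then almost every path of length three joins a hub to a non-hub.  Paths
    whose ends lie on the same side receive an extra factor [eps], with
    [eps^4 >= 1/2]: the total weight over all pairs of ends drops to
    [(1 + eps)/2 * n^2] ([sum_paths]), whereas the average of the logarithm of the
    weight stays above [- ln 2], up to a small error, whatever the structure
    ([total_cost_le]).  For [eps^4 = 1/2] the proportion of double turns cancels;
    [eps = 16/19] is a rational number close to this value.

    Comparing arithmetic and geometric means of the weights over a random path
    whose middle arc is uniform ([arc_entropy], [path_entropy]) yields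
    [N^3 <= (35/19 + o(1)) n^4], that is at most [0.613 n^(4/3)] edges.  The
    root [alpha] of the equation exceeds 27/44 = 0.6136, which leaves room for all
    error terms, and is smaller than 0.6144; both facts are comparisons of
    rational numbers after the exponent is replaced by 5/27 ([alpha_fun_lo],
    [alpha_fun_hi]). *)

(** * Logarithms, means and finite sets *)

Lemma ln_le_subr1 (R : realType) (x : R) : 0 < x -> ln x <= x - 1.
Proof. by move=> x0; rewrite -{1}[x](addrNK 1) addrC le_ln1Dx //; lra. Qed.

Lemma ln2_ge0 (R : realType) : 0 <= ln 2 :> R.
Proof. by rewrite ln_ge0 // ler1n. Qed.

Lemma ln_mul4 (R : realType) (x1 x2 x3 x4 : R) : 0 < x1 -> 0 < x2 -> 0 < x3 -> 0 < x4 ->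
  ln (x1 * x2 * x3 * x4) = ln x1 + ln x2 + ln x3 + ln x4.
Proof. by move=> *; rewrite !lnM ?posrE ?mulr_gt0. Qed.

Lemma mean_product (R : realType) (T : finType) (A B : {set T}) (f h : T -> R) (k : R) :
  A != set0 -> B != set0 ->
  \sum_(u in A) \sum_(v in B) (f u + k + h v) / (#|A|%:R * #|B|%:R)
    = (\sum_(u in A) f u) / #|A|%:R + k + (\sum_(v in B) h v) / #|B|%:R.
Proof.
rewrite -!card_gt0 -!(ltr0n R) => A0 B0.
have row u : \sum_(v in B) (f u + k + h v) / (#|A|%:R * #|B|%:R)
    = f u / #|A|%:R + (k + (\sum_(v in B) h v) / #|B|%:R) / #|A|%:R.
  rewrite -mulr_suml big_split sumr_const -mulr_natr /=; field.
  by rewrite !gt_eqF.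
rewrite (eq_bigr _ (fun u _ => row u)) big_split -mulr_suml sumr_const -mulr_natr /=.
by field; rewrite !gt_eqF.
Qed.

Lemma exists_outside (T : finType) (A : {set T}) (s : seq T) :
  (size s < #|A|)%N -> exists2 x, x \in A & x \notin s.
Proof.
move=> sA; have /subsetPn[x xA xs] : ~~ (A \subset s).
  by apply: contraL sA => /subset_leq_card As; rewrite -leqNgt (leq_trans As) ?card_size.
by exists x.
Qed.

(** * Three-edge paths in a hexagon-free graph *)

Definition hexagon_free (T : finType) (e : rel T) : Prop :=
  forall a b c d f g, uniq [:: a; b; c; d; f; g] ->
    ~~ [&& e a b, e b c, e c d, e d f, e f g & e g a].

Section Graph.
Local Open Scope nat_scope.

Variables (T : finType) (e : rel T).

Definition nbr (a : T) : {set T} := [set b | e a b].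
Definition common (a b : T) : {set T} := nbr a :&: nbr b.
Definition arcs : nat := \sum_a #|nbr a|.

(** A C4 on [u a b c] makes [u] and [b] have several common neighbours; up to two
    are tolerated, so that the turn meets at most one C4. *)
Definition good_turn (u a b : T) : bool :=
  [&& e u a, e a b, u != b, ~~ e u b & #|common u b| <= 2].

Definition double_turn (u a b : T) : bool :=
  good_turn u a b && (#|common u b| == 2).

Hypotheses (e_sym : symmetric e) (e_irr : irreflexive e).
Hypothesis hexF : hexagon_free e.

Lemma in_nbr a b : (b \in nbr a) = e a b.
Proof. by rewrite inE. Qed.

Lemma in_common a b c : (c \in common a b) = e c a && e c b.
Proof. by rewrite !inE !(e_sym c). Qed.

Lemma commonC a b : common a b = common b a.
Proof. exact: setIC. Qed.

Lemma good_turnC u a b : good_turn u a b = good_turn b a u.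
Proof.
by rewrite /good_turn commonC (e_sym u a) (e_sym a b) (e_sym u b) eq_sym andbCA.
Qed.

Lemma double_turnC u a b : double_turn u a b = double_turn b a u.
Proof. by rewrite /double_turn good_turnC commonC. Qed.

Lemma edge_neq a b : e a b -> a != b.
Proof. by apply: contraTneq => ->; rewrite e_irr. Qed.

(* closes the symmetric variants of hypotheses about edges and inequalities *)
Local Ltac sym_done :=
  first [done | by rewrite e_sym | by rewrite eq_sym
        | by apply: edge_neq; rewrite // e_sym].

Lemma edge_sep a b c : e a c -> ~~ e b c -> a != b.
Proof. by move=> ac; apply: contraNneq => <-. Qed.

Lemma no_hexagon a b c d f g :
  e a b -> e b c -> e c d -> e d f -> e f g -> e g a ->
  a != c -> a != d -> a != f -> b != d -> b != f -> b != g ->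
  c != f -> c != g -> d != g -> False.
Proof.
move=> ab bc cd df fg ga ac ad af bd bf bg cf cg dg.
have := @hexF a b c d f g; rewrite ab bc cd df fg ga /= => H.
suff: uniq [:: a; b; c; d; f; g] by move/H.
by rewrite /= !inE !negb_or ac ad af bd bf bg cf cg dg !edge_neq // e_sym.
Qed.

(** Otherwise [u a b v d c] is a hexagon: the turn conditions supply exactly the
    inequalities between vertices at distance two on it. *)
Lemma good_paths_meet u v a b c d :
  good_turn u a b -> good_turn a b v -> good_turn u c d -> good_turn c d v ->
  a = c \/ b = d.
Proof.
move=> /and5P[ua ab ub nub _] /and5P[_ bv av nav _].
move=> /and5P[uc cd ud nud _] /and5P[_ dv cv ncv _].
case: (eqVneq a c) => [|ac]; first by left.
case: (eqVneq b d) => [|bd]; first by right.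
exfalso; apply: (@no_hexagon u a b v d c) => //; rewrite 1?[e _ _]e_sym //.
- by apply: contraNneq nav => <-; rewrite e_sym.
- by rewrite eq_sym; apply: (edge_sep dv).
- by apply: contraNneq ncv => <-.
- by rewrite eq_sym.
Qed.

Definition good_path u v (p : T * T) : bool :=
  good_turn u p.1 p.2 && good_turn p.1 p.2 v.

Definition double_path u v (p : T * T) : bool :=
  double_turn u p.1 p.2 || double_turn p.1 p.2 v.

Lemma good_pathC u v a b : good_path u v (a, b) = good_path v u (b, a).
Proof. by rewrite /good_path /= andbC (good_turnC u) (good_turnC a). Qed.

Lemma double_pathC u v a b : double_path u v (a, b) = double_path v u (b, a).
Proof. by rewrite /double_path /= orbC (double_turnC u) (double_turnC a). Qed.

Lemma good_turn_common u a b : good_turn u a b -> a \in common u b.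
Proof. by case/and5P=> ua ab _ _ _; rewrite in_common e_sym ua. Qed.

(** A third path has to meet both of the given ones, so it also starts with [u a];
    the bound on the common neighbours of [a] and [v] does the rest. *)
Lemma good_paths_fork u v a b b' p :
  good_path u v (a, b) -> good_path u v (a, b') -> b != b' ->
  good_path u v p ->
  [/\ p \in setX [set a] (common a v), #|common a v| = 2 & double_path u v p].
Proof.
move=> /andP[/= t1 t2] /andP[/= t1' t2'] bb' /andP[]; case: p => c d /= s1 s2.
have ca : c = a.
  case: (good_paths_meet s1 s2 t1 t2) => // db.
  case: (good_paths_meet s1 s2 t1' t2') => // db'.
  by rewrite -db db' eqxx in bb'.
subst c.
have card2 : #|common a v| = 2.
  apply/eqP; rewrite eqn_leq; case/and5P: (t2) => _ _ _ _ -> /=.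
  have <- : #|[set b; b']| = 2 by rewrite cards2 bb'.
  by apply/subset_leq_card/subsetP => x; rewrite !inE => /orP[]/eqP->;
    [have := good_turn_common t2 | have := good_turn_common t2']; rewrite !inE.
split=> //; first by rewrite in_setX inE eqxx; exact: good_turn_common s2.
by rewrite /double_path /double_turn /= s2 card2 orbT.
Qed.

(** This is what makes the weights 1 and 1/2 of single and double paths add up to at
    most 1 for given ends. *)
Lemma good_paths_le2 u v (Q := [set p | good_path u v p]) :
  #|Q| <= 1 \/ #|Q| <= 2 /\ (forall p, p \in Q -> double_path u v p).
Proof.
case: (leqP #|Q| 1) => [|/card_gt1P[[a b] [[a' b'] []]]]; first by left.
rewrite !inE => p1 p2 p12; right.
have := p2; have := p1; rewrite /good_path /= => /andP[t1 t2] /andP[t1' t2'].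
case: (good_paths_meet t1 t2 t1' t2') => E; subst.
  have bb' : b != b' by apply: contraNneq p12 => ->.
  have H p := good_paths_fork p1 p2 bb' (p := p).
  have [_ c2 _] := H _ p1.
  split=> [|p]; last by rewrite inE => /H[].
  rewrite -c2 -[X in _ <= X]mul1n -(cards1 a') -cardsX subset_leq_card //.
  by apply/subsetP => p; rewrite inE => /H[].
have aa' : a != a' by apply: contraNneq p12 => ->.
have H c d : good_path u v (c, d) -> _ :=
  fun h => good_paths_fork (etrans (good_pathC _ _ _ _) p1)
    (etrans (good_pathC _ _ _ _) p2) aa' (etrans (good_pathC v u d c) h).
have [_ c2 _] := H _ _ p1.
split=> [|[c d]]; last by rewrite inE double_pathC => /H[].
rewrite -c2 -[X in _ <= X]muln1 -(cards1 b') -cardsX subset_leq_card //.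
by apply/subsetP => -[c d]; rewrite inE => /H[]; rewrite !in_setX andbC.
Qed.

(** With two such [u], [u'] one finds a hexagon [b p u a u' q], where [p] and [q] are
    further common neighbours of [b] with [u] and with [u']. *)
Lemma rich_turns_le1 a b :
  e a b -> #|[set u | [&& e u a, u != b, ~~ e u b & 2 < #|common u b|]]| <= 1.
Proof.
move=> ab; rewrite leqNgt; apply/negP => /card_gt1P[u [u' []]].
rewrite !inE => /and4P[ua ub nub c] /and4P[u'a u'b nu'b c'] uu'.
have [p] := exists_outside (s := [:: a]) (ltnW c).
rewrite in_common !inE => /andP[pu pb] pa.
have [q] := exists_outside (s := [:: a; p]) c'.
rewrite in_common !inE negb_or => /andP[qu' qb] /andP[qa qp].
apply: (@no_hexagon b p u a u' q) => //; try by sym_done.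
- by apply: edge_sep pb nu'b.
- by rewrite eq_sym; apply: edge_sep qb nub.
Qed.

(** With [y <> y'] the hexagon is [x p y i y' q]; four common neighbours are enough to
    choose [p] and [q] distinct and off the path [y i y']. *)
Lemma heavy_triangles_unique x i y y' :
  3 < #|common x y| -> 3 < #|common x y'| -> e x y -> e x y' ->
  e x i -> e i y -> e i y' -> y = y'.
Proof.
move=> c c' xy xy' xi iy iy'; apply/eqP/negPn/negP => yy'.
have [p] := exists_outside (s := [:: i; y']) (ltnW c).
rewrite in_common !inE negb_or => /andP[px py] /andP[pi py'].
have [q] := exists_outside (s := [:: i; y; p]) c'.
rewrite in_common !inE !negb_or => /andP[qx qy'] /and3P[qi qy qp].
by apply: (@no_hexagon x p y i y' q) => //; sym_done.
Qed.

Definition heavy t (x y : T) : bool := e x y && (t < #|common x y|).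

(** Double counting of triangles [x y i] with [x y] heavy: the edge [x i] determines
    [y], so heavy edges are few and can be deleted. *)
Lemma heavy_deg t x : 3 <= t ->
  #|[set y | heavy t x y]| * t.+1 <= #|nbr x|.
Proof.
move=> t3; rewrite -sum_nat_const.
rewrite (@leq_trans (\sum_(y in [set y | heavy t x y]) #|common x y|)) //.
  by apply: leq_sum => p; rewrite inE => /andP[].
under eq_bigr do rewrite -sum1_card.
rewrite (exchange_big_dep [in nbr x]) /=; last first.
  by move=> y i _; rewrite in_setI => /andP[].
rewrite -sum1_card leq_sum // => i; rewrite in_nbr => xi.
rewrite sum1dep_card leqNgt; apply/negP => /card_gt1P[y [y' []]].
rewrite !inE => /andP[/andP[xy c] /andP[_ yi]] /andP[/andP[xy' c'] /andP[_ yi']].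
apply/negP/negPn/eqP; apply: (@heavy_triangles_unique x i); rewrite ?(leq_ltn_trans t3) //.
all: by rewrite e_sym.
Qed.

(** Let [c] be the second common neighbour of [u] and [b], and [d] the second common
    neighbour of [a] and [v].  Then [u a d v b c] is a hexagon unless [v] is adjacent
    to [u] or to [c], which leaves boundedly many [v]. *)
Lemma opposite_doubles t u a b :
  (forall x y, e x y -> #|common x y| <= t) -> double_turn u a b ->
  #|[set v | double_turn a b v]| <= t.+2.
Proof.
move=> light /andP[/and5P[ua ab ub nub _] c2].
have [c] := @exists_outside _ (common u b) [:: a] ltac:(by rewrite (eqP c2)).
rewrite in_common !inE => /andP[cu cb] ca.
suff H : [set v | double_turn a b v] \subset common u b :|: common c b.
  rewrite (leq_trans (subset_leq_card H)) // (leq_trans (leq_card_setU _ _)) //.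
  by rewrite (eqP c2) -(addn2 t) addnC leq_add2r light.
apply/subsetP => v; rewrite in_set in_setU !in_common.
move=> /andP[/and5P[_ bv av nav _] d2].
rewrite !(e_sym v b) bv !andbT; apply: contraT; rewrite negb_or => /andP[vu vc].
have [d] := @exists_outside _ (common a v) [:: b] ltac:(by rewrite (eqP d2)).
rewrite in_common !inE => /andP[da dv] db.
exfalso; apply: (@no_hexagon u a d v b c) => //; try by sym_done.
- by rewrite eq_sym; apply: (edge_sep dv); rewrite e_sym.
- by apply: contraNneq nub => ->; rewrite e_sym.
- by apply: contraNneq vc => <-; rewrite e_sym.
- by apply: contraNneq vu => ->.
Qed.

(** * Forked arcs *)

Section Light.
Variable t : nat.
Hypothesis light : forall x y, e x y -> #|common x y| <= t.

Lemma good_turns_many a b :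
  e a b -> #|nbr a| <= #|[set u | good_turn u a b]| + t.+2.
Proof.
move=> ab; set rich := [set u | [&& e u a, u != b, ~~ e u b & 2 < #|common u b|]].
have sub : nbr a \subset
    [set u | good_turn u a b] :|: (([set b] :|: rich) :|: common a b).
  apply/subsetP => u; rewrite in_nbr => au.
  rewrite !inE /good_turn (e_sym u a) au ab (e_sym b u) /= leqNgt.
  by case: eqVneq => //= _; case: (e u b); case: (_ < _).
rewrite (leq_trans (subset_leq_card sub)) // (leq_trans (leq_card_setU _ _)) //.
rewrite leq_add2l (leq_trans (leq_card_setU _ _)) // -(add2n t) leq_add ?light //.
by rewrite (leq_trans (leq_card_setU _ _)) // cards1 add1n ltnS rich_turns_le1.
Qed.

(** In a K_{2,s} with [s] large these are the arcs that enter one of the two vertices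
    of degree [s]; the threshold is the bound of [opposite_doubles]. *)
Definition forked (a b : T) : bool := t.+2 < #|[set v | double_turn a b v]|.
Definition forks (b : T) : {set T} := [set a | forked a b].

Lemma forked_edge a b : forked a b -> e a b.
Proof.
move=> /(leq_ltn_trans (leq0n _))/card_gt0P[v].
by rewrite inE => /andP[/and5P[]].
Qed.

Lemma forked_asym a b : forked a b -> ~~ forked b a.
Proof.
move=> ab; apply/negP => ba; have /card_gt0P[u] := leq_ltn_trans (leq0n _) ba.
by rewrite inE double_turnC => /(opposite_doubles light); rewrite leqNgt => /negP[].
Qed.

Lemma forks_sub b : forks b \subset nbr b.
Proof. by apply/subsetP => a; rewrite !inE => /forked_edge; rewrite e_sym. Qed.

(** A double turn [a b v] that has an end outside [forks b] is one of at most [t + 2]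
    turns leaving that end, so up to a linear error double turns live on
    [forks b * forks b]. *)
Lemma double_turns_le b :
  \sum_(a in nbr b) \sum_(v in nbr b) double_turn a b v
    <= #|forks b| ^ 2 + 2 * (t.+2 * #|nbr b|).
Proof.
have row a : a \notin forks b -> \sum_(v in nbr b) double_turn a b v <= t.+2.
  rewrite inE -leqNgt => /(leq_trans _); apply.
  rewrite big_mkcond /= -sum1dep_card [leqRHS]big_mkcond leq_sum // => v _.
  by case: (v \in _); case: double_turn.
rewrite (@leq_trans (\sum_(a in nbr b) \sum_(v in nbr b)
  ((a \in forks b) * (v \in forks b) + (a \notin forks b) * double_turn a b v
   + (v \notin forks b) * double_turn v b a))) //.
  apply: leq_sum => a _; apply: leq_sum => v _; rewrite (double_turnC v).
  by case: (_ \in _); case: (_ \in _); case: double_turn.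
have split2 : \sum_(a in nbr b) \sum_(v in nbr b)
    ((a \notin forks b) * double_turn a b v) <= t.+2 * #|nbr b|.
  rewrite mulnC -sum_nat_const leq_sum // => a _; rewrite -big_distrr /=.
  by case: (boolP (a \in _)) => [|/row]; rewrite ?mul0n ?mul1n.
under eq_bigr do rewrite 2!big_split /=.
rewrite 2!big_split /= mul2n -addnn addnA !leq_add //; last by rewrite exchange_big.
rewrite -big_distrlr /= leq_mul //.
all: rewrite -big_mkcondr /= sum1dep_card subset_leq_card //.
all: by apply/subsetP => x; rewrite !inE => /andP[].
Qed.

(** * The average cost of a path *)

Section Weights.
Local Open Scope ring_scope.

Variables (R : realType) (z : R).
Hypothesis deg_big : forall a b, e a b -> t.+2%:R <= z * #|nbr a|%:R.

Let N : R := arcs%:R.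
Let deg a : R := #|nbr a|%:R.
Let fork a : R := #|forks a|%:R.
Let r : R := \sum_a fork a.

(** The bipartition by majority vote of the entering arcs; the vote is almost
    unanimous at most vertices if most paths have a double turn. *)
Definition hub (u : T) : bool := (#|nbr u| < 2 * #|forks u|)%N.

(** The cost of a path is an upper bound, in units of [ln 2], for minus the logarithm
    of its weight, split so that each summand depends on one turn or on one arc.
    Besides double turns it charges 1/4 for each deviation from the pattern in which
    the side of a vertex decides which arcs entering it are forked, and exactly one
    arc of each edge is forked; a path without deviations joins a hub to a non-hub. *)
Definition turn_cost (u a b : T) : R :=
  (double_turn u a b)%:R + 1 / 4 * ((hub u != forked a u)%:R
    + (forked u a == forked a u)%:R + (forked u a != forked b a)%:R).

Definition arc_cost (a b : T) : R := 1 / 4 * (forked a b == forked b a)%:R.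

Lemma sum_deg : N = \sum_a deg a.
Proof. by rewrite /N /arcs natr_sum. Qed.

Lemma isolated_or_deg_big a : deg a = 0 /\ fork a = 0 \/ 0 < deg a /\ t.+2%:R <= z * deg a.
Proof.
rewrite /deg /fork; case: (set_0Vmem (nbr a)) => [E|[b ab]].
  by left; have := subset_leq_card (forks_sub a); rewrite E cards0 leqn0 => /eqP->.
right; split; first by rewrite ltr0n; apply/card_gt0P; exists b.
by apply: (@deg_big a b); rewrite -in_nbr.
Qed.

Lemma fork_le_deg a : fork a <= deg a.
Proof. by rewrite ler_nat subset_leq_card ?forks_sub. Qed.

Lemma sum_nbrC (f : T -> T -> R) :
  \sum_a \sum_(b in nbr a) f a b = \sum_a \sum_(b in nbr a) f b a.
Proof.
rewrite (exchange_big_dep predT) //=; apply: eq_bigr => a _.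
by apply: eq_bigl => b; rewrite !in_nbr e_sym.
Qed.

Lemma sum_forked b : \sum_(a in nbr b) (forked a b)%:R = fork b.
Proof.
rewrite -natr_sum -big_mkcondr sum1dep_card; congr _%:R; apply: eq_card => a.
rewrite !inE andbC; case: (boolP (forked a b)) => //= /forked_edge.
by rewrite e_sym.
Qed.

Lemma sum_not_forked b : \sum_(a in nbr b) (~~ forked a b)%:R = deg b - fork b.
Proof.
rewrite -sum_forked /deg -sum1_card natr_sum -sumrB; apply: eq_bigr => a _.
by case: forked; rewrite ?subrr ?subr0.
Qed.

Lemma sum_double_turn a :
  (\sum_(u in nbr a) \sum_(b in nbr a) (double_turn u a b)%:R) / deg a
    <= fork a ^+ 2 / deg a + 2 * z * deg a.
Proof.
case: (isolated_or_deg_big a) => [[-> _]|[d0 zd]]; first by rewrite !invr0 !mulr0 addr0.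
have := double_turns_le a; rewrite -(ler_nat R) natr_sum.
under eq_bigr do rewrite natr_sum.
rewrite natrD natrX !natrM -/(deg a) -/(fork a) => H.
rewrite ler_pdivrMr // (le_trans H) //.
have E : fork a ^+ 2 / deg a * deg a = fork a ^+ 2 by rewrite divfK ?gt_eqF.
have : t.+2%:R * deg a <= z * deg a * deg a by rewrite ler_pM2r.
lra.
Qed.

(** The left side is [min (fork u) (deg u - fork u)], and a minimum [min x (1 - x)]
    with [x] in [[0, 1]] is at most [2 * x * (1 - x)]. *)
Lemma sum_hub_mismatch u :
  \sum_(a in nbr u) (hub u != forked a u)%:R <= 2 * fork u * (deg u - fork u) / deg u.
Proof.
case: (isolated_or_deg_big u) => [[d0 f0]|[d0 _]].
  rewrite big1 ?f0 ?mulr0 ?mul0r // => a; rewrite in_nbr => ua.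
  by move/eqP: d0; rewrite pnatr_eq0 cards_eq0 => /eqP/setP/(_ a); rewrite !inE ua.
have fd := fork_le_deg u; have f0 : 0 <= fork u by rewrite ler0n.
rewrite ler_pdivlMr //; case: (boolP (hub u)) => h.
  under eq_bigr do rewrite -[true != _]/(~~ _).
  rewrite sum_not_forked mulrC ler_wpM2r ?subr_ge0 //.
  by move: h; rewrite /hub -(ltr_nat R) natrM => /ltW.
under eq_bigr do rewrite eq_sym eqbF_neg negbK.
rewrite sum_forked -mulrA mulrCA ler_wpM2l //.
move: h; rewrite /hub -leqNgt -(ler_nat R) natrM -/(deg u) -/(fork u); lra.
Qed.

Lemma sum_unforked_arcs :
  \sum_a \sum_(b in nbr a) (forked a b == forked b a)%:R = N - 2 * r :> R.
Proof.
rewrite (eq_bigr (fun a => \sum_(b in nbr a)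
    (1 - (forked a b)%:R - (forked b a)%:R))); last first.
  move=> a _; apply: eq_bigr => b _; have := @forked_asym a b.
  by case: (forked a b) => [/(_ isT)|_]; case: (forked b a) => //= *; ring.
under eq_bigr do rewrite 2!sumrB sum_forked.
rewrite 2!sumrB (sum_nbrC (fun a b => (forked a b)%:R)).
under [X in _ - X - _]eq_bigr do rewrite sum_forked.
rewrite -/r sum_deg (eq_bigr deg); first by ring.
by move=> a _; rewrite sumr_const.
Qed.

Lemma sum_fork_changes a :
  (\sum_(u in nbr a) \sum_(b in nbr a) (forked u a != forked b a)%:R) / deg a
    = 2 * fork a * (deg a - fork a) / deg a.
Proof.
congr (_ / _).
rewrite (eq_bigr (fun u => (forked u a)%:R * (deg a - fork a)
    + (~~ forked u a)%:R * fork a)); last first.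
  move=> u _; case: (forked u a); rewrite ?mul1r ?mul0r ?addr0 ?add0r.
    by rewrite -sum_not_forked; apply: eq_bigr => b _; case: forked.
  by rewrite -sum_forked; apply: eq_bigr => b _; case: forked.
by rewrite big_split /= -!big_distrl /= sum_forked sum_not_forked; ring.
Qed.

Lemma sum_const_div a (f : T -> R) :
  (\sum_(u in nbr a) \sum_(b in nbr a) f u) / deg a = \sum_(u in nbr a) f u.
Proof.
rewrite mulr_suml; apply: eq_bigr => u ua; rewrite sumr_const -mulr_natr mulfK //.
by rewrite pnatr_eq0 -lt0n; apply/card_gt0P; exists u.
Qed.

(** Here the coefficient 1/4 pays off: the sum of [fork ^ 2 / deg], which is what
    double turns cost, cancels against the deviations, which are expensive exactly
    when this sum is small. *)
Lemma sum_turn_cost :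
  \sum_a (\sum_(u in nbr a) \sum_(b in nbr a) turn_cost u a b) / deg a
    <= N / 4 + r / 2 + 2 * z * N.
Proof.
have E a : (\sum_(u in nbr a) \sum_(b in nbr a) turn_cost u a b) / deg a
  = (\sum_(u in nbr a) \sum_(b in nbr a) (double_turn u a b)%:R) / deg a
  + 1 / 4 * (\sum_(u in nbr a) (hub u != forked a u)%:R
    + \sum_(u in nbr a) (forked u a == forked a u)%:R
    + (\sum_(u in nbr a) \sum_(b in nbr a) (forked u a != forked b a)%:R) / deg a).
  under eq_bigr do rewrite big_split -mulr_sumr 2!big_split /=.
  rewrite big_split -mulr_sumr 2!big_split /= mulrDl -mulrA !mulrDl.
  by rewrite 2!sum_const_div.
under eq_bigr do rewrite E.
rewrite big_split -mulr_sumr 2!big_split /=.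
have := sum_unforked_arcs; rewrite sum_nbrC => ->.
rewrite (sum_nbrC (fun a u => (hub u != forked a u)%:R)).
have H1 := ler_sum (index_enum T) (fun a (_ : true) => sum_double_turn a).
have H2 := ler_sum (index_enum T) (fun a (_ : true) => sum_hub_mismatch a).
rewrite (eq_bigr _ (fun a (_ : true) => sum_fork_changes a)).
rewrite big_split -mulr_sumr -sum_deg /= in H1.
have H3 : \sum_a fork a ^+ 2 / deg a + \sum_a 2 * fork a * (deg a - fork a) / deg a / 2 = r.
  rewrite -big_split; apply: eq_bigr => a _.
  case: (isolated_or_deg_big a) => [[-> ->]|[d0 _]] /=; first by rewrite expr0n /= !mul0r mulr0 !mul0r addr0.
  by field; rewrite gt_eqF.
rewrite -mulr_suml in H3.
lra.
Qed.

Lemma sum_arc_cost : \sum_a \sum_(b in nbr a) arc_cost a b = (N - 2 * r) / 4.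
Proof.
by under eq_bigr do rewrite -mulr_sumr; rewrite -mulr_sumr sum_unforked_arcs; field.
Qed.

Lemma fork_sum_le : 2 * r <= N.
Proof.
rewrite -subr_ge0 -sum_unforked_arcs.
by apply: sumr_ge0 => a _; apply: sumr_ge0 => b _; rewrite ler0n.
Qed.

(** * Path weights and their logarithms *)

Variable eps : R.
Hypotheses (eps_gt0 : 0 < eps) (eps_le1 : eps <= 1) (eps4 : 1 / 2 <= eps ^+ 4).

Definition side_weight (u v : T) : R := if hub u == hub v then eps else 1.

Definition path_weight (u v : T) (p : T * T) : R :=
  (if double_path u v p then 1 / 2 else 1) * side_weight u v.

Lemma side_weight_gt0 u v : 0 < side_weight u v.
Proof. by rewrite /side_weight; case: ifP. Qed.

Lemma path_weight_gt0 u v p : 0 < path_weight u v p.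
Proof. by rewrite mulr_gt0 ?side_weight_gt0 //; case: ifP => // _; lra. Qed.

Lemma sum_path_weight u v :
  \sum_(p | good_path u v p) path_weight u v p <= side_weight u v.
Proof.
rewrite -mulr_suml ler_piMl ?(ltW (side_weight_gt0 _ _)) //.
rewrite (eq_bigl [in [set p | good_path u v p]]); last by move=> p; rewrite inE.
have [c1|[c2 dbl]] := good_paths_le2 u v.
  apply: (@le_trans _ _ (\sum_(p in [set p | good_path u v p]) 1)).
    by apply: ler_sum => p _; case: ifP => // _; lra.
  by rewrite sumr_const lern1.
rewrite (eq_bigr (fun=> 1 / 2)); last by move=> p /dbl ->.
rewrite sumr_const -mulr_natr; move: c2; rewrite -(ler_nat R); lra.
Qed.

Lemma sum_side_weight :
  \sum_u \sum_v side_weight u v <= (1 + eps) / 2 * #|T|%:R ^+ 2.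
Proof.
(* signs turn the sum over pairs on the same side into a square *)
pose s u : R := if hub u then 1 else - 1.
pose S := \sum_u s u.
have row u : \sum_v side_weight u v
    = (1 + eps) / 2 * #|T|%:R - (1 - eps) / 2 * S * s u.
  rewrite [X in _ - X]mulrAC /S mulr_sumr mulr_natr -sumr_const -sumrB.
  apply: eq_bigr => v _; rewrite /side_weight /s.
  by case: (hub u); case: (hub v) => /=; field.
under eq_bigr do rewrite row.
rewrite sumrB sumr_const -mulr_sumr -/S -[X in X - _]mulr_natr.
have : 0 <= (1 - eps) / 2 * S * S by rewrite -mulrA -expr2 mulr_ge0 ?sqr_ge0 ?divr_ge0 ?subr_ge0.
rewrite expr2; lra.
Qed.

(** Walking along [u a b v] through the states side of [u], [a -> u] forked,
    [u -> a] not forked, and so on up to not the side of [v], the two ends lie on the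
    same side only if some consecutive states differ; each difference is one
    deviation charged by the costs. *)
Lemma mismatch_chain (x i1 i2 i3 i4 i5 i6 y : bool) :
  ((x == y) <= (x != i1) + (i2 == i1) + (i2 != i3) + (i4 == i3)
     + ((y != i6) + (i5 == i6) + (i5 != i4)))%N.
Proof. by case: x i1 i2 i3 i4 i5 i6 y => [] [] [] [] [] [] [] []. Qed.

Lemma ln_path_weight u a b v :
  - ln 2 * (turn_cost u a b + arc_cost a b + turn_cost v b a)
    <= ln (path_weight u v (a, b)).
Proof.
have lneps : - ln 2 <= 4 * ln eps.
  rewrite mulr_natl -lnXn // -lnV ?posrE ?ltr0n //.
  by rewrite ler_ln ?posrE ?exprn_gt0 ?invr_gt0 ?ltr0n // -div1r.
have := @mismatch_chain (hub u) (forked a u) (forked u a) (forked b a)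
  (forked a b) (forked v b) (forked b v) (hub v).
rewrite -(ler_nat R) !natrD.
rewrite /turn_cost /arc_cost /path_weight lnM ?posrE ?side_weight_gt0 //; last first.
  by case: ifP => // _; lra.
have -> : ln (if double_path u v (a, b) then 1 / 2 else 1) =
    - ln 2 * (double_path u v (a, b))%:R :> R.
  by case: ifP; rewrite ?ln1 ?mulr0 // div1r lnV ?posrE ?mulr1.
have -> : ln (side_weight u v) = ln eps * (hub u == hub v)%:R.
  by rewrite /side_weight; case: ifP; rewrite ?ln1 ?mulr0 ?mulr1.
rewrite /double_path /= (double_turnC a b v).
set s := (hub u == hub v)%:R => chain.
have d12 : (double_turn u a b || double_turn v b a)%:R <=
    (double_turn u a b)%:R + (double_turn v b a)%:R :> R.
  by rewrite -natrD ler_nat; do 2!case: double_turn.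
have s0 : 0 <= s by rewrite ler0n.
have := mulr_ge0 (ln2_ge0 R) (etrans (subr_ge0 _ _) d12).
have := mulr_ge0 (ln2_ge0 R) (etrans (subr_ge0 _ _) chain).
have : 0 <= (4 * ln eps + ln 2) * s by rewrite mulr_ge0 //; lra.
lra.
Qed.

(** * The mean of the logarithm is at most the logarithm of the mean *)

Hypothesis z01 : 0 <= z < 1.

Let turns (a b : T) : {set T} := [set u | good_turn u a b].
Let nturns a b : R := #|turns a b|%:R.

(** Exact numbers of good turns are used to make the random path a probability
    distribution; this lemma compares it with the simple random walk. *)
Lemma nturns_ge a b : e a b -> (1 - z) * deg a <= nturns a b.
Proof.
move=> ab; have := good_turns_many ab; rewrite -(ler_nat R) natrD.
have := deg_big ab; rewrite -/(deg a) -/(nturns a b); lra.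
Qed.

Lemma deg_gt0 a b : e a b -> 0 < deg a.
Proof. by move=> ab; rewrite ltr0n; apply/card_gt0P; exists b; rewrite in_nbr. Qed.

Lemma nturns_gt0 a b : e a b -> 0 < nturns a b.
Proof.
move=> ab; apply: lt_le_trans (nturns_ge ab); rewrite mulr_gt0 ?(deg_gt0 ab) //.
by rewrite subr_gt0; case/andP: z01.
Qed.

Definition mean_cost a b : R := (\sum_(u in turns a b) turn_cost u a b) / nturns a b.

Let total : R := (1 + eps) / 2 * #|T|%:R ^+ 2.

(** Extend the arc [a b] by a uniformly random good turn on either side.  The lemma is
    the mean of [ln x <= x - 1], where [x] is the weight of a path divided by its
    probability and by the bound [total] on the total weight. *)
Lemma arc_entropy a b : e a b -> 0 < total -> 0 < N ->
  - ln 2 * (mean_cost a b + arc_cost a b + mean_cost b a)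
    + (ln (N / total) + ln (nturns a b) + ln (nturns b a))
  <= N / total * (\sum_(u in turns a b) \sum_(v in turns b a) path_weight u v (a, b)) - 1.
Proof.
move=> ab t0 N0; have ba : e b a by rewrite e_sym.
have sa := nturns_gt0 ab; have sb := nturns_gt0 ba.
have : 0 < N / total by rewrite divr_gt0.
set q := N / total => q0; set c := ln q + _ + _.
have term u v : (- ln 2 * turn_cost u a b + (- ln 2 * arc_cost a b + c)
      + - ln 2 * turn_cost v b a) / (nturns a b * nturns b a)
  <= q * path_weight u v (a, b) - (nturns a b * nturns b a)^-1.
  rewrite ler_pdivrMr ?mulr_gt0 //.
  have g0 := path_weight_gt0 u v (a, b).
  have E : c + ln (path_weight u v (a, b)) =
    ln (q * nturns a b * nturns b a * path_weight u v (a, b)).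
    by rewrite ln_mul4.
  have X0 : 0 < q * nturns a b * nturns b a * path_weight u v (a, b).
    by do 3!apply: mulr_gt0 => //.
  have := ln_le_subr1 X0; rewrite -E.
  rewrite mulrBl mulVf ?gt_eqF ?mulr_gt0 //.
  have := ln_path_weight u a b v; lra.
have := ler_sum (index_enum T) (fun u (_ : u \in turns a b) =>
  ler_sum (index_enum T) (fun v (_ : v \in turns b a) => term u v)).
rewrite mean_product; last 2 first.
- by rewrite -card_gt0 -(ltr0n R).
- by rewrite -card_gt0 -(ltr0n R).
under [X in _ <= X -> _]eq_bigr do rewrite sumrB -mulr_sumr sumr_const.
rewrite sumrB -mulr_sumr sumr_const.
have -> : (nturns a b * nturns b a)^-1 *+ #|turns b a| *+ #|turns a b| = 1.
  by rewrite -mulrnA -mulr_natr natrM mulrC [_%:R * _]mulrC mulfV ?mulf_neq0 ?gt_eqF.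
rewrite -!mulr_sumr -/(nturns a b) -/(nturns b a) /mean_cost; lra.
Qed.

Lemma sum_paths : \sum_a \sum_(b in nbr a)
    (\sum_(u in turns a b) \sum_(v in turns b a) path_weight u v (a, b)) <= total.
Proof.
pose w u v p := if good_path u v p then path_weight u v p else 0.
have w0 u v p : 0 <= w u v p.
  by rewrite /w; case: ifP => // _; rewrite ltW ?path_weight_gt0.
have E a b : \sum_(u in turns a b) \sum_(v in turns b a) path_weight u v (a, b)
    = \sum_u \sum_v w u v (a, b).
  rewrite big_mkcond; apply: eq_bigr => u _; rewrite inE /w /good_path /=.
  case: (good_turn u a b); last by rewrite big1.
  by rewrite big_mkcond; apply: eq_bigr => v _; rewrite inE good_turnC.
apply: (@le_trans _ _ (\sum_a \sum_b \sum_u \sum_v w u v (a, b))).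
  apply: ler_sum => a _; rewrite big_mkcond; apply: ler_sum => b _.
  by rewrite E; case: ifP => // _; do 2!apply: sumr_ge0 => ? _.
rewrite (pair_bigA _ (fun a b => \sum_u \sum_v w u v (a, b))) /= exchange_big /=.
apply: le_trans sum_side_weight; apply: ler_sum => u _.
rewrite exchange_big; apply: ler_sum => v _ /=.
apply: le_trans (sum_path_weight u v); rewrite [leRHS]big_mkcond /=.
by apply: ler_sum => -[].
Qed.

Lemma sum_mean_cost : \sum_a \sum_(b in nbr a) mean_cost a b
    <= (N / 4 + r / 2 + 2 * z * N) / (1 - z).
Proof.
have z1 : 0 < 1 - z by rewrite subr_gt0; case/andP: z01.
rewrite ler_pdivlMr // mulr_suml (le_trans _ sum_turn_cost) //.
have cost0 u a b : 0 <= turn_cost u a b.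
  by rewrite /turn_cost addr_ge0 ?ler0n // mulr_ge0 ?divr_ge0 // !addr_ge0 ?ler0n.
apply: ler_sum => a _; rewrite [in leRHS]exchange_big /= !mulr_suml.
apply: ler_sum => b; rewrite in_nbr => ab.
rewrite -mulrA ler_pM ?sumr_ge0 //.
- by rewrite mulr_ge0 ?ltW // invr_gt0 nturns_gt0.
- rewrite [leLHS]big_mkcond [leRHS]big_mkcond; apply: ler_sum => u _ /=.
  rewrite !inE; case: (boolP (good_turn u a b)) => [/and5P[ua _ _ _ _]|_].
    by rewrite e_sym ua.
  by case: ifP.
rewrite mulrC ler_pdivrMr ?nturns_gt0 // -ler_pdivrMl ?invr_gt0 ?(deg_gt0 ab) //.
by rewrite invrK mulrC nturns_ge.
Qed.

(** Convexity of [d * ln d], obtained from [ln x <= x - 1] at the quotient of the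
    average degree by the degree. *)
Lemma sum_ln_nturns : 0 < N ->
  N * (ln (1 - z) + ln (N / #|T|%:R)) <= \sum_a \sum_(b in nbr a) ln (nturns a b).
Proof.
move=> N0; have z1 : 0 < 1 - z by rewrite subr_gt0; case/andP: z01.
have n0 : 0 < #|T|%:R :> R.
  rewrite ltr0n lt0n; apply: contraTneq N0 => T0; rewrite sum_deg big1 ?ltxx // => a.
  by have := max_card (pred1 a); rewrite T0 card1.
set q := N / #|T|%:R; have q0 : 0 < q by rewrite divr_gt0.
have arc a b : e a b -> ln (1 - z) + ln q + 1 - q / deg a <= ln (nturns a b).
  move=> ab; have d0 := deg_gt0 ab.
  have : ln ((1 - z) * deg a) <= ln (nturns a b).
    by rewrite ler_ln ?posrE ?mulr_gt0 ?(nturns_gt0 ab) // nturns_ge.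
  have : ln (q / deg a) <= q / deg a - 1 by rewrite ln_le_subr1 ?divr_gt0.
  rewrite (@ln_div _ q (deg a)) ?posrE // (@lnM _ (1 - z)) ?posrE //; lra.
have -> : N * (ln (1 - z) + ln q) = \sum_a (deg a * (ln (1 - z) + ln q + 1) - q).
  rewrite sumrB -mulr_suml -sum_deg sumr_const -[q *+ _]mulr_natr /q divfK ?gt_eqF //.
  ring.
have fill a : deg a * (ln (1 - z) + ln q + 1) - q
    <= \sum_(b in nbr a) (ln (1 - z) + ln q + 1 - q / deg a).
  rewrite sumr_const -mulr_natl -/(deg a) mulrBr lerD2l lerN2.
  case: (isolated_or_deg_big a) => [[-> _]|[d0 _]]; first by rewrite mul0r ltW.
  by rewrite mulrC divfK ?gt_eqF.
apply: ler_sum => a _; apply: le_trans (fill a) _.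
by apply: ler_sum => b; rewrite in_nbr; apply: arc.
Qed.

(** The number of forked arcs still appears in the average cost, with a coefficient
    that makes [2 * r = N] the worst case, where the cost is one unit per path. *)
Lemma total_cost_le :
  2 * (\sum_a \sum_(b in nbr a) mean_cost a b) + \sum_a \sum_(b in nbr a) arc_cost a b
    <= N * ((1 + 4 * z) / (1 - z)).
Proof.
have z1 : 0 < 1 - z by rewrite subr_gt0; case/andP: z01.
have Hr := fork_sum_le; rewrite sum_arc_cost.
have HN : (N - 2 * r) / 4 <= (N - 2 * r) / 4 / (1 - z).
  rewrite ler_peMr ?divr_ge0 ?subr_ge0 // invf_ge1 //.
  by case/andP: z01 => z0 _; rewrite lerBlDr lerDl.
apply: (@le_trans _ _ ((N / 2 + r + 4 * z * N + (N - 2 * r) / 4) / (1 - z))).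
  by move: sum_mean_cost HN; move: (1 - z)^-1 => i; lra.
by rewrite mulrA ler_pM2r ?invr_gt0 //; lra.
Qed.

Lemma path_entropy : 0 < N -> 0 < total ->
  ln (N / total) + 2 * ln (N / #|T|%:R)
    <= ln 2 * ((1 + 4 * z) / (1 - z)) - 2 * ln (1 - z).
Proof.
move=> N0 t0; have z1 : 0 < 1 - z by rewrite subr_gt0; case/andP: z01.
have := ler_sum (index_enum T) (fun a (_ : true) => ler_sum (index_enum T)
  (fun b (h : b \in nbr a) => arc_entropy (etrans (esym (in_nbr a b)) h) t0 N0)).
have cst (c : R) : \sum_a c *+ #|nbr a| = c * N.
  by rewrite sum_deg mulr_sumr; apply: eq_bigr => a _; rewrite mulr_natr.
under [X in X <= _ -> _]eq_bigr do
  rewrite big_split -mulr_sumr 2!big_split big_split /= big_split sumr_const /=.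
rewrite big_split -mulr_sumr 2!big_split big_split /= big_split cst /=.
rewrite -(sum_nbrC mean_cost) -(sum_nbrC (fun a b => ln (nturns a b))).
under [X in _ <= X -> _]eq_bigr do rewrite sumrB -mulr_sumr sumr_const.
rewrite sumrB -mulr_sumr -sum_deg.
set A := \sum_a \sum_(b in nbr a) mean_cost a b.
set C := \sum_a \sum_(b in nbr a) arc_cost a b.
set B := \sum_a \sum_(b in nbr a) ln (nturns a b).
set P := \sum_a \sum_(b in nbr a) _ => main.
have HP : N / total * P <= N.
  by rewrite -mulrA [_^-1 * _]mulrC ler_piMr ?(ltW N0) // ler_pdivrMr // mul1r sum_paths.
have HB : N * (ln (1 - z) + ln (N / #|T|%:R)) <= B := sum_ln_nturns N0.
have HC : 2 * A + C <= N * ((1 + 4 * z) / (1 - z)) := total_cost_le.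
have HC2 := ler_wpM2l (ln2_ge0 R) HC; rewrite -(ler_pM2l N0).
move: HC2 main HP HB; clear.
by move: (N / total * P) ((1 + 4 * z) / _) (ln (N / total)) (ln (N / _)) => *; lra.
Qed.

End Weights.
End Light.
End Graph.

(** [eps = 16/19] satisfies [eps^4 >= 1/2], so the limit constant is
    [1 + 16/19 = 35/19]; the slack up to 24/13 is the factor 456/455, whose logarithm
    is at least 1/456 and absorbs the contribution [7 * (z / (1 - z))] of [z]. *)
Lemma entropy_bound_numeric (R : realType) (z N n : R) :
  0 <= z < 1 -> 7 * (z / (1 - z)) <= 1 / 456 -> 0 < N -> 0 < n ->
  ln (N / ((1 + 16 / 19) / 2 * n ^+ 2)) + 2 * ln (N / n)
    <= ln 2 * ((1 + 4 * z) / (1 - z)) - 2 * ln (1 - z) ->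
  N ^+ 3 <= 24 / 13 * n ^+ 4.
Proof.
move=> /andP[z0 z1] zk N0 n0; have w0 : 0 < 1 - z by rewrite subr_gt0.
have -> : (1 + 4 * z) / (1 - z) = 1 + 5 * (z / (1 - z)).
  by field; rewrite gt_eqF.
have ln_z : - ln (1 - z) <= z / (1 - z).
  have -> : z / (1 - z) = (1 - z)^-1 - 1 by field; rewrite gt_eqF.
  by rewrite -lnV ?posrE ?ln_le_subr1 ?invr_gt0.
have k0 : 0 <= z / (1 - z) by rewrite divr_ge0 // ltW.
move: (z / (1 - z)) k0 zk ln_z => k k0 zk ln_z.
have lnE (x : R) : 0 < x -> ln (N / (x * n ^+ 2)) = ln N - (ln x + 2 * ln n).
  move=> x0; rewrite ln_div ?posrE ?mulr_gt0 ?exprn_gt0 //.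
  by rewrite lnM ?posrE ?exprn_gt0 // lnXn // mulr_natl.
rewrite lnE; last by lra.
rewrite (@ln_div _ N n) ?posrE //.
have ln_2 : ln 2 <= 1 :> R.
  by have := @ln_le_subr1 R 2 (ltr0Sn _ _); lra.
have ln_2k : 0 <= (1 - ln 2) * k by rewrite mulr_ge0 // subr_ge0.
have ln_y : 1 - 455 / 456 <= ln (456 / 455) :> R.
  have := @ln_le_subr1 R (455 / 456) ltac:(lra).
  by rewrite -[455 / 456]invf_div lnV ?posrE; lra.
have ln_c : ln (24 / 13) = ln ((1 + 16 / 19) / 2) + ln 2 + ln (456 / 455) :> R.
  by rewrite -!lnM ?posrE; [congr ln; field | lra..].
have lnR : ln (24 / 13 * n ^+ 4) = ln (24 / 13) + 4 * ln n.
  by rewrite lnM ?posrE ?exprn_gt0 // ?lnXn ?mulr_natl //; lra.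
move=> H; rewrite -ler_ln ?posrE ?exprn_gt0 //; last first.
  by rewrite mulr_gt0 ?exprn_gt0 //; lra.
have lnN3 : ln (N ^+ 3) = 3 * ln N by rewrite lnXn // mulr_natl.
rewrite lnR ln_c lnN3; lra.
Qed.

Lemma hexagon_free_arcs_light (R : realType) (T : finType) (e : rel T) (t : nat) (z : R) :
  symmetric e -> irreflexive e -> hexagon_free e ->
  (forall x y, e x y -> (#|common e x y| <= t)%N) ->
  (forall x y, e x y -> t.+2%:R <= z * #|nbr e x|%:R :> R) ->
  0 <= z < 1 -> 7 * (z / (1 - z)) <= 1 / 456 ->
  (arcs e)%:R ^+ 3 <= 24 / 13 * #|T|%:R ^+ 4 :> R.
Proof.
move=> e_sym e_irr hexF light deg_big z01 zk.
have [->|] := posnP (arcs e).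
  by rewrite expr0n mulr_ge0 ?exprn_ge0 ?divr_ge0.
rewrite -(ltr0n R) => N0.
have n0 : 0 < #|T|%:R :> R.
  rewrite ltr0n lt0n; apply: contraTneq N0 => T0; rewrite /arcs big1 ?ltxx // => a.
  by have := max_card (pred1 a); rewrite T0 card1.
apply: (entropy_bound_numeric z01 zk N0 n0).
apply: (path_entropy e_sym e_irr hexF light deg_big) => //; try lra.
by rewrite mulr_gt0 ?exprn_gt0 //; lra.
Qed.

(** * Pruning *)

Definition restrict (T : finType) (e : rel T) (W : {set T}) : rel T :=
  fun x y => [&& x \in W, y \in W & e x y].

Lemma hexagon_free_sub (T : finType) (e e' : rel T) :
  subrel e' e -> hexagon_free e -> hexagon_free e'.
Proof.
move=> sub hexF a b c d f g /hexF; apply: contra.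
by move=> /and5P[? ? ? ? /andP[? ?]]; rewrite !sub.
Qed.

Lemma common_sub (T : finType) (e e' : rel T) x y :
  subrel e' e -> common e' x y \subset common e x y.
Proof.
by move=> sub; apply/subsetP => w; rewrite !inE => /andP[? ?]; rewrite !sub.
Qed.

Lemma arcs_heavy (T : finType) (e : rel T) t :
  symmetric e -> irreflexive e -> hexagon_free e -> (2 < t)%N ->
  let light := fun x y => e x y && ~~ heavy e t x y in
  exists2 h, (h * t.+1 <= arcs e)%N & arcs e = (arcs light + h)%N.
Proof.
move=> e_sym e_irr hexF t2 light; exists (\sum_x #|[set y | heavy e t x y]|)%N.
  by rewrite big_distrl leq_sum // => x _; apply: heavy_deg.
rewrite /arcs -big_split; apply: eq_bigr => x _ /=.
rewrite -(cardsID [set y | heavy e t x y] (nbr e x)) addnC.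
by congr addn; apply: eq_card => y; rewrite !inE /light /heavy; case: (e x y); rewrite ?andbT.
Qed.

Lemma restrict_arcs (T : finType) (e : rel T) (W : {set T}) :
  arcs (restrict e W) = (\sum_(x in W) #|nbr e x :&: W|)%N.
Proof.
rewrite /arcs [RHS]big_mkcond; apply: eq_bigr => x _.
case: ifP => xW; last by apply: eq_card0 => y; rewrite !inE /restrict xW.
by apply: eq_card => y; rewrite !inE /restrict xW /= andbC.
Qed.

Lemma restrict_remove (T : finType) (e : rel T) (W : {set T}) v :
  symmetric e -> irreflexive e -> v \in W ->
  arcs (restrict e W) = (arcs (restrict e (W :\ v)) + 2 * #|nbr e v :&: W|)%N.
Proof.
move=> e_sym e_irr vW; rewrite !restrict_arcs (big_setD1 v) //=.
have -> : (\sum_(x in W :\ v) #|nbr e x :&: W|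
    = \sum_(x in W :\ v) #|nbr e x :&: (W :\ v)| + #|nbr e v :&: W|)%N; last by lia.
have -> : #|nbr e v :&: W| = (\sum_(x in W :\ v) e v x)%N.
  rewrite -big_mkcondr sum1dep_card; apply: eq_card => x; rewrite !inE.
  by case: eqVneq => [->|_]; rewrite ?e_irr ?andbF // andbC.
rewrite -big_split; apply: eq_bigr => x _ /=.
by rewrite (cardsD1 v (nbr e x :&: W)) !inE vW andbT e_sym addnC setIDA.
Qed.

(** A vertex set maximizing the number of inner arcs plus [2 * M] for every omitted
    vertex: omitting one more vertex of inner degree below [M] would improve it. *)
Lemma exists_min_degree (T : finType) (e : rel T) M :
  symmetric e -> irreflexive e -> exists W : {set T},
    (forall x y, restrict e W x y -> M <= #|nbr (restrict e W) x|)%N /\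
    (arcs e <= arcs (restrict e W) + 2 * M * #|T|)%N.
Proof.
move=> e_sym e_irr.
pose score W := (arcs (restrict e W) + 2 * M * #|~: W|)%N.
case: (@arg_maxnP _ setT predT score isT) => W _ Wmax.
exists W; split=> [x y /and3P[xW yW xy]|].
  have -> : nbr (restrict e W) x = nbr e x :&: W.
    by apply/setP => w; rewrite !inE /restrict xW /= andbC.
  have := Wmax (W :\ x) isT; rewrite /score (restrict_remove e_sym e_irr xW).
  have -> : #|~: (W :\ x)| = #|~: W|.+1.
    by rewrite setCD setUC cardsU1 !inE xW.
  by lia.
have := Wmax setT isT; rewrite /score setCT cards0 muln0 addn0.
have -> : arcs (restrict e setT) = arcs e.
  by apply: eq_bigr => x _; apply: eq_card => y; rewrite !inE /restrict !inE.
move=> /leq_trans; apply; rewrite leq_add2l leq_mul2l max_card orbT //.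
Qed.

(** [24/13 < (27/22)^3 * (1 - 1/2500)^3]: both deletions together may remove a
    proportion 1/2500 of the arcs, that is [2 / t] with [t] at least 5000. *)
Lemma pruning_numeric (R : realType) (N N1 N2 h n M t : R) :
  0 <= n -> 0 <= N -> 50 * 100 <= t ->
  2 * M * t * n <= N -> h * t <= N -> N1 <= N2 + 2 * M * n -> N = N1 + h ->
  N2 ^+ 3 <= 24 / 13 * n ^+ 4 -> N ^+ 3 <= (27 / 22) ^+ 3 * n ^+ 4.
Proof.
move=> n0 N0 t_ge Mt ht N1_le NE cube.
have t0 : 0 <= t by lra.
have drop : (N - N2) * t <= 2 * N.
  by have := ler_wpM2r t0 N1_le; rewrite NE in ht Mt *; lra.
have N2_ge : (1 - 1 / (25 * 100)) * N <= N2.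
  rewrite leNgt; apply/negP => lt; have lt' : 0 <= N - N2 by lra.
  by have := ler_wpM2l lt' t_ge; lra.
have : ((1 - 1 / (25 * 100)) * N) ^+ 3 <= N2 ^+ 3.
  by rewrite lerXn2r ?nnegrE ?(le_trans _ N2_ge) ?mulr_ge0 //; lra.
have : 0 <= n ^+ 4 by rewrite exprn_ge0.
have : 0 <= N ^+ 3 by rewrite exprn_ge0.
rewrite exprMn; move: (n ^+ 4) (N ^+ 3) (N2 ^+ 3) cube => x y w; lra.
Qed.

Lemma hexagon_free_arcs_large (R : realType) (T : finType) (e : rel T) (t M : nat) :
  symmetric e -> irreflexive e -> hexagon_free e ->
  (50 * 100 <= t)%N -> (80 * 40 * t.+2 <= M)%N -> ((2 * M * t.+1) ^ 3 <= #|T|)%N ->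
  (arcs e)%:R ^+ 3 <= (27 / 22) ^+ 3 * #|T|%:R ^+ 4 :> R.
Proof.
move=> e_sym e_irr hexF t_big M_big T_big; rewrite leNgt; apply/negP => big.
have t2 : (2 < t)%N by apply: leq_trans t_big.
have [h h_le arcsE] := arcs_heavy e_sym e_irr hexF t2.
move: arcsE; set light : rel T := fun x y => _ => arcsE.
have light_sub : subrel light e by move=> x y /andP[].
have light_sym : symmetric light.
  by move=> x y; rewrite /light /heavy (commonC e x) (e_sym x).
have light_irr : irreflexive light by move=> x; rewrite /light e_irr.
have [W [W_deg W_arcs]] := exists_min_degree M light_sym light_irr.
have W_sub : subrel (restrict light W) light by move=> x y /and3P[].
have W_e : subrel (restrict light W) e by move=> x y /W_sub/light_sub.
pose z : R := (80 * 40)^-1.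
have bound : (arcs (restrict light W))%:R ^+ 3 <= 24 / 13 * #|T|%:R ^+ 4 :> R.
  apply: (@hexagon_free_arcs_light R T (restrict light W) t z).
  - by move=> x y; rewrite /restrict light_sym andbCA.
  - by move=> x; rewrite /restrict light_irr !andbF.
  - exact: hexagon_free_sub W_e hexF.
  - move=> x y xy; have /andP[exy] := W_sub _ _ xy; rewrite /heavy exy -leqNgt.
    by apply: leq_trans; rewrite subset_leq_card // common_sub.
  - move=> x y xy; rewrite ler_pdivlMl; last by lra.
    by rewrite -!natrM ler_nat (leq_trans M_big) // (W_deg _ y).
  - by rewrite /z; lra.
  have -> : z / (1 - z) = (80 * 40 - 1)^-1 by rewrite /z; field; lra.
  by rewrite ler_pdivrMr; lra.
set N2 := (arcs (restrict light W))%:R in bound.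
have n0 : 0 <= #|T|%:R :> R by [].
set n := #|T|%:R in bound big n0.
pose c : R := (2 * M * t.+1)%:R.
have cn : c ^+ 3 <= n by rewrite -natrX ler_nat.
(* a violated conclusion makes [N] at least [n^(4/3)], and [n^(1/3)] is at least [c] *)
have cN : c * n <= (arcs e)%:R.
  rewrite leNgt; apply/negP => lt_cn; move: big; apply/negP; rewrite -leNgt.
  apply: (@le_trans _ _ (n ^+ 4)).
    apply: (@le_trans _ _ ((c * n) ^+ 3)); first by rewrite lerXn2r ?nnegrE ?mulr_ge0 // ltW.
    by rewrite exprMn (exprS n 3) ler_wpM2r ?exprn_ge0.
  by rewrite ler_peMl ?exprn_ge0 //; lra.
move: h_le; rewrite -(ler_nat R) natrM => h_le.
move: W_arcs; rewrite -(ler_nat R) natrD !natrM -/N2 -/n => W_arcs.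
have {arcsE} : (arcs e)%:R = (arcs light)%:R + h%:R :> R by rewrite arcsE natrD.
move=> NE.
have t_R : 50 * 100 <= t.+1%:R :> R by rewrite -natrM ler_nat leqW.
rewrite /c !natrM in cN; move: big; rewrite ltNge => /negP; apply.
exact: (pruning_numeric (ler0n R _) (ler0n R _) t_R cN h_le W_arcs NE bound).
Qed.

(** * From edge sets to relations *)

Definition adj (T : finType) (E : {set {set T}}) : rel T := fun u v => [set u; v] \in E.

Lemma adj_sym (T : finType) (E : {set {set T}}) : symmetric (adj E).
Proof. by move=> u v; rewrite /adj setUC. Qed.

Lemma adj_irr (T : finType) (E : {set {set T}}) : simple_graph E -> irreflexive (adj E).
Proof.
move=> /forall_inP simpleE u; apply/negP => /simpleE.
by rewrite setUid cards1.
Qed.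

Lemma adj_hexagon_free (T : finType) (E : {set {set T}}) :
  ~~ has_copy (cycle_graph 6) E -> hexagon_free (adj E).
Proof.
move=> noC6 a b c d f g uniq_s; apply: contra noC6 => /and5P[ab bc cd df /andP[fg ga]].
apply/existsP; exists [ffun i : 'I_6 => nth a [:: a; b; c; d; f; g] i].
apply/andP; split.
  apply/injectiveP => i j; rewrite !ffunE => /eqP.
  by rewrite nth_uniq ?ltn_ord // => /eqP/val_inj.
apply/forall_inP => _ /imsetP[i _ ->]; rewrite imsetU1 imset_set1 !ffunE.
by case: i => -[|[|[|[|[|[|//]]]]]].
Qed.

Lemma double_edges_le_arcs (T : finType) (E : {set {set T}}) :
  simple_graph E -> (2 * #|E| <= arcs (adj E))%N.
Proof.
move=> /forall_inP simpleE; rewrite /arcs.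
under eq_bigr do rewrite -sum1_card big_mkcond.
rewrite (pair_bigA _ (fun u v => if v \in nbr (adj E) u then 1%N else 0%N)) /=.
rewrite -big_mkcond (partition_big (fun p => [set p.1; p.2]) [in E]) /=; last first.
  by move=> p; rewrite inE.
rewrite mulnC -sum_nat_const leq_sum // => A AE.
have /cards2P[x [y [xy AE']]] := simpleE A AE.
rewrite sum1dep_card; apply/card_gt1P; exists (x, y), (y, x).
by rewrite !inE /adj /= (setUC [set y]) -AE' AE eqxx /= xpair_eqE negb_and xy.
Qed.

Lemma cube_powR (R : realType) (n : nat) : (n%:R `^ (4 / 3)) ^+ 3 = n%:R ^+ 4 :> R.
Proof.
by rewrite -[LHS]powR_mulrn ?powR_ge0 // -powRrM divfK ?pnatr_eq0 // -powR_mulrn.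
Qed.

(** The factor 27/44 is half of 27/22, since arcs count every edge twice. *)
Lemma hexagon_turan (R : realType) : exists n0 : nat, forall n, (n0 <= n)%N ->
  (turan_number n (cycle_graph 6))%:R <= 27 / 44 * n%:R `^ (4 / 3) :> R.
Proof.
have [t t_big] : exists t, (50 * 100 <= t)%N by exists (50 * 100)%N.
pose M := (80 * 40 * t.+2)%N.
exists ((2 * M * t.+1) ^ 3)%N => n n_big.
have bound (E : {set {set 'I_n}}) : simple_graph E && ~~ has_copy (cycle_graph 6) E ->
    #|E|%:R <= 27 / 44 * n%:R `^ (4 / 3) :> R.
  move=> /andP[simpleE noC6].
  have := @hexagon_free_arcs_large R 'I_n (adj E) t M (@adj_sym _ E) (adj_irr simpleE)
    (adj_hexagon_free noC6) t_big (leqnn _).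
  rewrite card_ord => /(_ n_big) cube.
  have := double_edges_le_arcs simpleE; rewrite -(ler_nat R) natrM => edges.
  move: cube; rewrite -cube_powR -exprMn ler_pXn2r ?nnegrE ?mulr_ge0 ?invr_ge0 ?powR_ge0 //.
  by move: (n%:R `^ _) (arcs _)%:R (#|E|%:R) edges => x a b; lra.
pose K (k : nat) : Prop := k%:R <= 27 / 44 * n%:R `^ (4 / 3) :> R.
rewrite -/(K _) /turan_number; apply: (big_ind K) => [|k l kK lK|//]; last by rewrite /maxn; case: ifP.
by rewrite /K mulr_ge0 ?divr_ge0 ?powR_ge0.
Qed.

(** * The constant alpha *)

Definition alpha_fun (R : realType) (t : R) : R :=
  4 * t ^+ 3 * ((3 / 2) `^ (1 - 1 / (2 * t))).

Lemma alpha_fun_lt (R : realType) (x y : R) : 0 < x -> x < y -> alpha_fun x < alpha_fun y.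
Proof.
move=> x0 xy; have y0 := lt_trans x0 xy.
have le_pow : (3 / 2) `^ (1 - 1 / (2 * x)) <= (3 / 2) `^ (1 - 1 / (2 * y)) :> R.
  rewrite ler_powR //; first by lra.
  by rewrite lerD2l lerN2 !div1r lef_pV2 ?posrE ?mulr_gt0 // ler_pM2l // ltW.
rewrite /alpha_fun; apply: lt_le_trans (_ : 4 * y ^+ 3 * (3 / 2) `^ (1 - 1 / (2 * x)) <= _).
  by rewrite ltr_pM2r ?powR_gt0 ?ltr_pM2l ?ltrXn2r ?nnegrE ?ltW //; lra.
by rewrite ler_wpM2l // mulr_ge0 // exprn_ge0 // ltW.
Qed.

Lemma expr27_alpha_fun (R : realType) (a : R) :
  0 < a -> (a * (3 / 2) `^ (5 / 27)) ^+ 27 = a ^+ 27 * (3 / 2) ^+ 5.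
Proof.
move=> a0; rewrite exprMn -[((3 / 2) `^ _) ^+ 27]powR_mulrn ?powR_ge0 //.
by rewrite -powRrM divfK ?pnatr_eq0 // powR_mulrn //; lra.
Qed.

(** At 27/44 the exponent [1 - 1 / (2 * t)] equals 5/27, so the 27th power is
    rational. *)
Lemma alpha_fun_lo (R : realType) : alpha_fun (27 / 44 : R) < 1.
Proof.
rewrite /alpha_fun.
have -> : 1 - 1 / (2 * (27 / 44)) = 5 / 27 :> R by field.
rewrite -(@ltr_pXn2r _ 27) ?nnegrE ?mulr_ge0 ?powR_ge0 ?exprn_ge0 ?divr_ge0 ?invr_ge0 //.
rewrite expr27_alpha_fun ?mulr_gt0 ?exprn_gt0 ?divr_gt0 ?invr_gt0 //.
rewrite expr1n.
lra.
Qed.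

(** At 384/625 the exponent 143/768 is slightly larger than 5/27, so 5/27 can be used
    again. *)
Lemma alpha_fun_hi (R : realType) : 1 < alpha_fun (384 / 625 : R).
Proof.
rewrite /alpha_fun.
apply: lt_le_trans (_ : 4 * (384 / 625) ^+ 3 * (3 / 2) `^ (5 / 27) <= _); last first.
  rewrite ler_wpM2l ?mulr_ge0 ?exprn_ge0 ?divr_ge0 ?invr_ge0 //.
  by rewrite ler_powR //; lra.
rewrite -(@ltr_pXn2r _ 27) ?nnegrE ?mulr_ge0 ?powR_ge0 ?exprn_ge0 ?divr_ge0 ?invr_ge0 //.
rewrite expr27_alpha_fun ?mulr_gt0 ?exprn_gt0 ?divr_gt0 ?invr_gt0 //.
rewrite expr1n.
lra.
Qed.

Lemma alpha_fun_continuous (R : realType) (t : R) :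
  t != 0 -> {for t, continuous (@alpha_fun R)}.
Proof.
move=> t0; rewrite /alpha_fun /powR.
have -> : (3 / 2 == 0 :> R) = false by rewrite mulf_eq0 invr_eq0 !pnatr_eq0.
apply: cvgM; first by apply: cvgM; [exact: cvg_cst | exact: exprn_continuous].
apply: (cvg_comp _ expR); last exact: continuous_expR.
apply: cvgM; last exact: cvg_cst.
apply: cvgB; first exact: cvg_cst.
apply: cvgM; first exact: cvg_cst.
apply: cvgV; first by rewrite mulf_neq0 ?pnatr_eq0.
by apply: cvgM; [exact: cvg_cst | exact: cvg_id].
Qed.

Lemma alpha_fun_root (R : realType) :
  exists2 a : R, 27 / 44 < a < 384 / 625 & alpha_fun a = 1.
Proof.
have lo := alpha_fun_lo R; have hi := alpha_fun_hi R.
have le_ends : 27 / 44 <= 384 / 625 :> R by lra.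
have [||a /itvP a_itv a1] := @IVT R (@alpha_fun R) _ _ 1 le_ends.
- apply: continuous_in_subspaceT => x /classical_sets.set_mem/itvP x_itv.
  apply: alpha_fun_continuous; rewrite gt_eqF //.
  by apply: lt_le_trans (_ : 27 / 44 <= x); rewrite ?x_itv // divr_gt0.
- by rewrite ge_min le_max (ltW lo) (ltW hi) orbT.
exists a => //; rewrite !lt_neqAle !a_itv !andbT.
apply/andP; split; apply/eqP => E.
  by move: lo; rewrite E a1 ltxx.
by move: hi; rewrite -E a1 ltxx.
Qed.

Lemma linear_le_powR (R : realType) (d : R) : 0 < d ->
  exists n0 : nat, forall n : nat, (n0 <= n)%N -> n%:R < d * n%:R `^ (4 / 3) :> R.
Proof.
move=> d0; exists (Num.truncn ((d^-1) ^+ 3)).+2 => n n_big.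
have n0 : 0 < n%:R :> R by rewrite ltr0n (leq_trans _ n_big).
rewrite -(@ltr_pXn2r _ 3) ?nnegrE ?mulr_ge0 ?powR_ge0 ?ltW // exprMn cube_powR.
rewrite (exprS _ 3) mulrA -[ltLHS]mul1r ltr_pM2r ?exprn_gt0 //.
rewrite -ltr_pdivrMl ?exprn_gt0 // mulr1 -exprVn.
apply: lt_le_trans (truncnS_gt _) _.
by rewrite ler_nat (leq_trans _ n_big).
Qed.

(* 384 / 625 = 0.6144 *)
Theorem theorem1 (R : realType) :
  exists alpha : R, unique (fun t : R => alpha_eqn t) alpha /\
    exists (K : R) (n0 : nat), 0 < K /\
      forall n : nat, (n0 <= n)%N ->
        (turan_number n (cycle_graph 6))%:R <= alpha * n%:R `^ (4 / 3) + K * n%:R /\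
        alpha * n%:R `^ (4 / 3) + K * n%:R < 384 / 625 * n%:R `^ (4 / 3).
Proof.
have [a /andP[a_lo a_hi] a_root] := alpha_fun_root R.
exists a; split.
  split=> [|t [t_lo _ t_root]]; first by split=> //; lra.
  have [lt_at|lt_ta|//] := ltgtP a t.
    have := alpha_fun_lt (_ : 0 < a) lt_at; rewrite a_root.
    by rewrite /alpha_fun t_root ltxx => /(_ ltac:(lra)).
  have := alpha_fun_lt (_ : 0 < t) lt_ta; rewrite a_root.
  by rewrite /alpha_fun t_root ltxx => /(_ ltac:(lra)).
have [n1 bound] := hexagon_turan R.
have [n2 room] := linear_le_powR (etrans (subr_gt0 _ _) a_hi).
exists 1, (maxn n1 n2); split=> // n; rewrite geq_max => /andP[/bound ex_le /room lt_n].
have x0 := powR_ge0 n%:R (4 / 3 : R).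
have ax : 27 / 44 * n%:R `^ (4 / 3) <= a * n%:R `^ (4 / 3) by rewrite ler_wpM2r // ltW.
have n0 : 0 <= n%:R :> R := ler0n R n.
split; last by move: lt_n; rewrite mulrBl; lra.
by apply: le_trans ex_le _; lra.
Qed.
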